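(* One has $[a(1)]=[1]$, $[a(2),a(3)]=[1,2]$, and for every integer $m\ge 3$, as an equality of vectors of length $f_{m-1}$, $$[a(f_{m}-1),\dots,a(f_{m+1}-2)]=[a(f_{m-2}-1),\dots,a(f_{m-1}-2),a(f_{m-1}-1),\dots,a(f_{m}-2)]+[\underbrace{1,\dots,1}_{f_{m-1}}].$$
   Context: The Fibonacci sequence $\mathbb{F}$ is the infinite word over $\{a,b\}$ that is the fixed point beginning with $a$ of the morphism $\sigma(a)=ab$, $\sigma(b)=a$; positions are numbered from $1$, and $\mathbb{F}[1,n]$ is its prefix of length $n$. The numbers $f_m$ are given by $f_{-2}=0$, $f_{-1}=1$, $f_m=f_{m-1}+f_{m-2}$ for $m\ge 0$ (so $f_0=1,f_1=2,f_2=3$). $\mathcal{P}_F$ is the set of nonempty palindromes occurring as factors (finite contiguous subwords) of $\mathbb{F}$. For a factor $\omega$ and $p\ge1$, $\omega_p$ denotes the $p$-th occurrence of $\omega$ in $\mathbb{F}$. For $n\ge1$, $a(n)$ is the number of pairs $(\omega,p)$ with $\omega\in\mathcal{P}_F$, $p\ge1$, such that $\omega_p$ is a suffix of $\mathbb{F}[1,n]$, i.e. the $p$-th occurrence of $\omega$ ends exactly at position $n$. *)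

(* Defs.v *)
From HB Require Import structures.
From mathcomp Require Import all_boot finmap.
From mathcomp Require Import boolp classical_sets functions cardinality.

Set Implicit Arguments.
Unset Strict Implicit.
Unset Printing Implicit Defensive.

Local Open Scope classical_set_scope.

Inductive letter : Type := la | lb.

Definition bool_of_letter (x : letter) : bool :=
  match x with la => false | lb => true end.
Definition letter_of_bool (x : bool) : letter := if x then lb else la.
Lemma bool_of_letterK : cancel bool_of_letter letter_of_bool.
Proof. by case. Qed.
HB.instance Definition _ := Countable.copy letter (can_type bool_of_letterK).

Definition sigma (x : letter) : seq letter :=
  match x with la => [:: la; lb] | lb => [:: la] end.

Definition sigma_word (w : seq letter) : seq letter := flatten (map sigma w).

(* An infinite word is a function [F : nat -> letter] read at the positions
   1, 2, ...; the value [F 0] is never used. *)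

(* F[i,j], both ends included (empty when j < i). *)
Definition subword (F : nat -> letter) (i j : nat) : seq letter :=
  [seq F k | k <- index_iota i j.+1].

(* The infinite concatenation sigma(F 1) sigma(F 2) ... equals F, i.e. each
   of its finite partial concatenations is a prefix of F (sigma is
   non-erasing, so these determine the whole infinite word). *)
Definition sigma_fixed (F : nat -> letter) : Prop :=
  forall n : nat,
    sigma_word (subword F 1 n) =
    subword F 1 (size (sigma_word (subword F 1 n))).

Definition fibonacci_sequence (F : nat -> letter) : Prop :=
  F 1 = la /\ sigma_fixed F.

(* [fib k] is f_(k-2), so that f_(-2) = 0 and f_(-1) = 1. *)
Fixpoint fib (k : nat) : nat :=
  match k with
  | 0 => 0
  | 1 => 1
  | (k'.+1 as k1).+1 => fib k1 + fib k'
  end.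

Definition f (m : nat) : nat := fib m.+2.

Definition occurs_at (F : nat -> letter) (w : seq letter) (i : nat) : bool :=
  (1 <= i) && (w == subword F i (i + size w).-1).

Definition pal_factor (F : nat -> letter) (w : seq letter) : Prop :=
  [/\ w <> [::], rev w = w & exists i : nat, occurs_at F w i].

(* The p-th occurrence of w starts at position i: w occurs at i, and p of its
   occurrences start at one of the positions 1, ..., i. *)
Definition pth_occurrence (F : nat -> letter) (w : seq letter) (p i : nat) :
    bool :=
  occurs_at F w i && (count (occurs_at F w) (iota 1 i) == p).

(* The pairs (w, p) such that w_p is a suffix of F[1,n]; an occurrence of w
   starting at i ends at n when i + |w| - 1 = n. *)
Definition pal_occ_ending (F : nat -> letter) (n : nat) :
    set (seq letter * nat) :=
  [set wp | [/\ pal_factor F wp.1, 1 <= wp.2 &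
     exists i : nat, pth_occurrence F wp.1 wp.2 i /\ i + size wp.1 = n.+1]].

(* [fset_set] of an infinite set is empty; see [finite_pal_occ_ending]. *)
Definition a (F : nat -> letter) (n : nat) : nat :=
  #|` fset_set (pal_occ_ending F n) |%fset.

(* The vector [a(i), ..., a(j)]. *)
Definition avec (F : nat -> letter) (i j : nat) : seq nat :=
  [seq a F n | n <- index_iota i j.+1].

(* Only meaningful for vectors of the same length, since [zip] truncates. *)
Definition vadd (u v : seq nat) : seq nat := [seq x.1 + x.2 | x <- zip u v].

Lemma finite_pal_occ_ending (F : nat -> letter) (n : nat) :
  finite_set (pal_occ_ending F n).
Proof.
pose g i := let w := subword F i n in (w, count (occurs_at F w) (iota 1 i)).
apply: (@sub_finite_set _ _ [set` map g (iota 0 n.+2)]); last first.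
  exact: finite_seq.
move=> [w p] [/= _ _ [i [/andP[/andP[i1 /eqP wE] /eqP pE] iw]]].
suff: (w, p) \in map g (iota 0 n.+2) by [].
apply/mapP; exists i; first by rewrite mem_iota leq0n add0n ltnS -iw leq_addr.
by rewrite iw /= in wE; rewrite /g -wE pE.
Qed.

Lemma sigma_word_cat u v : sigma_word (u ++ v) = sigma_word u ++ sigma_word v.
Proof. by rewrite /sigma_word map_cat flatten_cat. Qed.

Definition fibonacci_word (i : nat) : letter :=
  nth la (iter i sigma_word [:: la]) i.-1.

Lemma fibonacci_wordP : fibonacci_sequence fibonacci_word.
Proof.
pose W k := iter k sigma_word [:: la].
have WS k : exists v, W k.+1 = W k ++ v.
  elim: k => [|k [v Wv]]; first by exists [:: lb].
  by exists (sigma_word v); rewrite /= -/(W k) -sigma_word_cat -Wv.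
have Wle k d : exists v, W (k + d) = W k ++ v.
  elim: d => [|d [v Wv]]; first by exists [::]; rewrite addn0 cats0.
  have [u Wu] := WS (k + d).
  by exists (v ++ u); rewrite addnS Wu Wv catA.
have szs w : size w <= size (sigma_word w).
  elim: w => [//|x w IH].
  rewrite -[sigma_word _]/(sigma x ++ sigma_word w) size_cat.
  by apply: (@leq_add 1) => //; case: x.
have szW k : k < size (W k).
  elim: k => [//|k IH]; have [v Wv] := Wle 0 k.
  rewrite add0n in Wv; rewrite /= -/(W k) Wv in IH *.
  rewrite sigma_word_cat size_cat /= in IH *.
  by rewrite !ltnS; apply: leq_trans (szs v); rewrite -ltnS.
have prefE n k : n <= k -> subword fibonacci_word 1 n = take n (W k).
  move=> nk; have nsz : n <= size (W k) by rewrite (leq_trans nk) // ltnW.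
  apply: (@eq_from_nth _ la).
    by rewrite /subword size_map size_iota subn1 size_takel.
  rewrite /subword size_map size_iota subn1 /= => i ilt.
  rewrite (nth_map 0) ?size_iota ?subn1 // nth_iota ?subn1 // nth_take //.
  have [v Wv] := Wle i.+1 (k - i.+1).
  rewrite subnKC in Wv; last exact: leq_trans nk.
  rewrite /fibonacci_word add1n /= -/(W i) -[sigma_word _]/(W i.+1) Wv.
  by rewrite nth_cat ltnW ?szW.
split=> // n.
set s := sigma_word _; set N := size s.
have Es : s = sigma_word (take n (W (maxn n N))).
  by rewrite /s (prefE n (maxn n N)) // leq_maxl.
have Ws : W (maxn n N).+1 = s ++ sigma_word (drop n (W (maxn n N))).
  by rewrite Es -sigma_word_cat cat_take_drop.
rewrite (prefE N (maxn n N).+1) ?Ws ?take_size_cat //.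
by rewrite (leq_trans (leq_maxr n N)).
Qed.

(* Main.v *)
(** Every palindromic suffix ending in [a] is [sigma v ++ a] with [v] a
    palindrome, and one ending in [b] extends by [a] on both sides to such a
    word.  Writing S(k) for the length of sigma(F[1,k]), this gives
    a(S(k)+1) = a(k) + 1, and a(S(k)+2) = a(k+1) when F(k+1) = a; these two
    forms cover all positive positions.  The prefix of length f_(m+1) - 2 has
    period f_m, so S(k + f_m) = S(k) + f_(m+1) on a suitable range of k, and
    a(n + f_(m+1)) = a(n) + 1 for f_m - 1 <= n <= f_(m+2) - 2 follows by
    induction on m. *)

Require Import Defs.
From mathcomp Require Import all_boot.
From mathcomp Require Import finmap zify.
From mathcomp Require Import classical_sets cardinality.

Set Implicit Arguments.
Unset Strict Implicit.
Unset Printing Implicit Defensive.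

(** * Prefixes and factors as finite words *)

Lemma subword_recr F i j :
  i <= j.+1 -> subword F i j.+1 = rcons (subword F i j) (F j.+1).
Proof.
move=> ij; rewrite /subword /index_iota subSn // -addn1 iotaD map_cat /=.
by rewrite subnKC // cats1.
Qed.

Lemma size_subword F i j : size (subword F i j) = j.+1 - i.
Proof. by rewrite size_map size_iota. Qed.

Lemma size_prefix F n : size (subword F 1 n) = n.
Proof. by rewrite size_subword subn1. Qed.

Lemma drop_prefix F i n : drop i (subword F 1 n) = subword F i.+1 n.
Proof.
by rewrite /subword /index_iota -map_drop drop_iota add1n subn1 subSS.
Qed.

Lemma sigma_word_rcons w x : sigma_word (rcons w x) = sigma_word w ++ sigma x.
Proof. by rewrite -cats1 sigma_word_cat /sigma_word /= cats0. Qed.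

(** * Palindromes and the morphism sigma *)

Definition palindrome (T : eqType) (w : seq T) := rev w == w.

Lemma palindrome_ends (T : eqType) (x y : T) w :
  palindrome (x :: rcons w y) = (x == y) && palindrome w.
Proof.
rewrite /palindrome rev_cons rev_rcons /= eqseq_cons eq_sym.
by case: eqP => //= ->; rewrite eqseq_rcons eqxx andbT.
Qed.

(** For a single letter both sides are aba or aa; block by block, the extra a moves from one end to
    the other. *)
Lemma rev_sigma_word w :
  la :: rev (sigma_word w) = sigma_word (rev w) ++ [:: la].
Proof.
elim: w => [//|x w IH].
rewrite rev_cons sigma_word_rcons.
rewrite -[sigma_word (x :: w)]/(sigma x ++ sigma_word w).
by rewrite rev_cat -cat_cons IH -!catA; case: x.
Qed.

(** No image begins with b, so the letter after an a decides whether the block is ab or a. *)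
Lemma sigma_word_inj : injective sigma_word.
Proof.
have nb w v : sigma_word w <> lb :: v by case: w => [|[] w].
elim=> [|[] u IH] [|[] v] //.
- by case=> /IH ->.
- by case=> /esym/nb.
- by case=> /nb.
- by case=> /IH ->.
Qed.

Lemma palindrome_sigma w : palindrome (sigma_word w ++ [:: la]) = palindrome w.
Proof.
rewrite /palindrome rev_cat [rev [:: _]]/= cat1s rev_sigma_word.
by rewrite !cats1 eqseq_rcons eqxx andbT (inj_eq sigma_word_inj).
Qed.

(** * Counting palindromic suffixes *)

Fixpoint pal_suffixes (w : seq letter) : nat :=
  if w is _ :: w' then palindrome w + pal_suffixes w' else 0.

(** A suffix starting with the b of a block ends in a and is no palindrome. The others are sigma(v)a
    with v a suffix of w; the empty v gives the extra one. *)
Lemma pal_suffixes_sigma_a w :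
  pal_suffixes (sigma_word w ++ [:: la]) = (pal_suffixes w).+1.
Proof.
elim: w => [//|x w IH].
have H := palindrome_sigma (x :: w).
case: x H => H; last by rewrite /= -[flatten _]/(sigma_word w) IH -H addnS.
have nb : palindrome (lb :: sigma_word w ++ [:: la]) = false.
  by rewrite cats1 palindrome_ends.
by rewrite /= -[flatten _]/(sigma_word w) IH nb -H add0n addnS.
Qed.

(** Only suffixes starting with b count. The final b matches the final a of wa; b sigma(v) ab is a
    palindrome exactly when v is, hence exactly when the suffix ava of wa is. *)
Lemma pal_suffixes_sigma_ab w :
  pal_suffixes (sigma_word w ++ [:: la; lb]) = pal_suffixes (rcons w la).
Proof.
elim: w => [//|x w IH].
have na v : palindrome (la :: v ++ [:: la; lb]) = false.
  by rewrite -(cat_rcons la v) cats1 palindrome_ends.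
have bab : palindrome (lb :: sigma_word w ++ [:: la; lb]) = palindrome w.
  by rewrite -(cat_rcons la) cats1 palindrome_ends -cats1 palindrome_sigma.
case: x; rewrite /= -[flatten _]/(sigma_word w) IH.
  by rewrite (na (lb :: _)) bab palindrome_ends.
by rewrite na palindrome_ends.
Qed.

Lemma pal_suffixesE w :
  pal_suffixes w = count (fun i => palindrome (drop i w)) (iota 0 (size w)).
Proof.
by elim: w => [//|x w IH]; rewrite /= IH (iotaDl 1 0) count_map.
Qed.

(** Once the end n is fixed, the start i determines both the word and its rank p, and distinct
    starts give distinct lengths; so pairs correspond to starts. *)
Lemma a_pal_suffixes F n : a F n = pal_suffixes (subword F 1 n).
Proof.
pose w i := subword F i n.
pose g i := (w i, count (occurs_at F (w i)) (iota 1 i)).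
pose L := [seq g i | i <- iota 1 n & palindrome (w i)].
have uL : uniq L.
  rewrite map_inj_in_uniq ?filter_uniq ?iota_uniq // => i j.
  rewrite !mem_filter !mem_iota => /andP[_ hi] /andP[_ hj] [/(congr1 size)].
  by rewrite !size_subword; lia.
rewrite /a; have -> : pal_occ_ending F n = [set` [fset x in L]%fset]%classic.
  apply/seteqP; split=> -[v p] /=.
    move=> [[/= vn rv _] /= p1 [i []]].
    move=> /andP[/= /andP[i1 /eqP vE] /eqP pE] /= iv.
    have {}vE : v = w i by rewrite vE iv.
    rewrite inE; apply/mapP; exists i; last by rewrite /g -vE pE.
    rewrite mem_filter mem_iota /palindrome -vE rv eqxx i1 /=.
    by case: v vn iv {vE rv pE} => //= *; lia.
  rewrite inE => /mapP[i]; rewrite mem_filter mem_iota.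
  move=> /andP[pi /andP[i1 iN]].
  have szw : i + size (w i) = n.+1 by rewrite size_subword; lia.
  have occ : occurs_at F (w i) i by rewrite /occurs_at i1 szw /=.
  case=> -> ->; split=> /=.
  - split; [|exact/eqP|by exists i].
    by move=> w0; move: szw; rewrite w0 /=; lia.
  - rewrite -has_count; apply/hasP; exists i => //.
    by rewrite mem_iota; lia.
  - by exists i; rewrite /pth_occurrence occ eqxx.
rewrite set_fsetK card_fseq undup_id // size_map size_filter.
rewrite pal_suffixesE size_prefix (iotaDl 1 0) count_map.
by apply: eq_count => i /=; rewrite drop_prefix.
Qed.

(** * Lengths of images of prefixes *)

Definition image_length F k := size (sigma_word (subword F 1 k)).

Lemma image_length0 F : image_length F 0 = 0.
Proof. by []. Qed.

Lemma image_lengthS F k :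
  image_length F k.+1 = image_length F k + (if F k.+1 is la then 2 else 1).
Proof.
by rewrite /image_length subword_recr // sigma_word_rcons size_cat; case: (F _).
Qed.

Lemma image_length_mono F j k : j <= k -> image_length F j <= image_length F k.
Proof.
move=> /subnKC<-; elim: (k - j) => [|d IH]; first by rewrite addn0.
by rewrite addnS image_lengthS (leq_trans IH) // leq_addr.
Qed.

(** The k letters after position p repeat the first k, so their images have the same total
    length. *)
Lemma image_length_add F k p :
  (forall i, 0 < i <= k -> F (i + p) = F i) ->
  image_length F (k + p) = image_length F k + image_length F p.
Proof.
elim: k => [//|k IH] per.
rewrite addSn !image_lengthS -addSn per ?ltnS ?leqnn // IH; first by lia.
by move=> i hi; apply: per; lia.
Qed.

(** * Block structure of the Fibonacci word *)

Section FibonacciWord.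

Variables (F : nat -> letter) (hF : fibonacci_sequence F).
Let S := image_length F.

Lemma prefix_image_length k : subword F 1 (S k) = sigma_word (subword F 1 k).
Proof. by case: hF => _ /(_ k). Qed.

Lemma prefix_image_length_sigma k :
  subword F 1 (S k) ++ sigma (F k.+1) = subword F 1 (S k.+1).
Proof. by rewrite !prefix_image_length subword_recr // sigma_word_rcons. Qed.

Lemma letter_image_length1 k : F (S k).+1 = la.
Proof.
have := prefix_image_length_sigma k; rewrite /S image_lengthS -/S.
case: (F k.+1); rewrite ?addn2 ?addn1 !subword_recr // -?cats1 -?catA.
  by move/eqP; rewrite eqseq_cat // eqxx => /eqP[].
by move/eqP; rewrite eqseq_cat // eqxx => /eqP[].
Qed.

Lemma letter_image_length2 k : F k.+1 = la -> F (S k).+2 = lb.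
Proof.
have := prefix_image_length_sigma k; rewrite /S image_lengthS -/S => + Fk.
rewrite Fk addn2 !subword_recr // -?cats1 -?catA.
by move/eqP; rewrite eqseq_cat // eqxx => /eqP[].
Qed.

(** A positive position is the first letter of a block sigma(F(k+1)) or the b of a block ab. *)
Variant image_position_spec : nat -> Type :=
| ImagePosition0 : image_position_spec 0
| ImagePosition1 k : image_position_spec (S k).+1
| ImagePosition2 k of F k.+1 = la : image_position_spec (S k).+2.

Lemma image_positionP n : image_position_spec n.
Proof.
elim: n => [|n [|k|k Fk]]; first exact: ImagePosition0.
- exact: (ImagePosition1 0).
- have := image_lengthS F k; case E: (F k.+1) => SE.
    exact: ImagePosition2.
  have -> : (S k).+2 = (S k.+1).+1 by rewrite /S SE addn1.
  exact: ImagePosition1.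
- have -> : (S k).+3 = (S k.+1).+1 by rewrite /S image_lengthS Fk addn2.
  exact: ImagePosition1.
Qed.

Lemma a0 : a F 0 = 0.
Proof. by rewrite a_pal_suffixes. Qed.

Lemma a_image_length1 k : a F (S k).+1 = (a F k).+1.
Proof.
rewrite !a_pal_suffixes subword_recr // prefix_image_length.
by rewrite letter_image_length1 -cats1 pal_suffixes_sigma_a.
Qed.

Lemma a_image_length2 k : F k.+1 = la -> a F (S k).+2 = a F k.+1.
Proof.
move=> Fk; rewrite !a_pal_suffixes !subword_recr // prefix_image_length.
rewrite letter_image_length1 letter_image_length2 // Fk.
by rewrite -!cats1 -catA pal_suffixes_sigma_ab cats1.
Qed.

Lemma image_length1 : S 1 = 2.
Proof. by rewrite /S image_lengthS image_length0 (proj1 hF). Qed.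

Lemma image_length2 : S 2 = 3.
Proof.
rewrite /S image_lengthS -/S image_length1.
by rewrite (@letter_image_length2 0 (proj1 hF)).
Qed.

(** * Periods of prefixes of Fibonacci length *)

Lemma fS m : f m.+2 = f m.+1 + f m.
Proof. by []. Qed.

Lemma f_gt0 m : 0 < f m.
Proof. by elim: m => // m IH; rewrite /f /= -/(f m) addn_gt0 IH. Qed.

(* The hypothesis holds for the prefixes of length n = f_m with m >= 1, whose
   last two letters are ab or ba. *)
Lemma image_length_pred n :
  2 <= n -> F n.-1 != F n -> S (n - 2) + 3 = S n.
Proof.
case: n => [|[|n]] //= _; rewrite subn2 /S !image_lengthS /=.
by case: (F n.+1); case: (F n.+2) => // _; lia.
Qed.

(** Since S(n-2) = S(n) - 3 and S is strictly increasing, both sides say k <= n-2. *)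
Lemma image_length_le n k : 2 <= n -> F n.-1 != F n ->
  (S k + 3 <= S n) = (k + 2 <= n).
Proof.
move=> n2 nF; have E := image_length_pred n2 nF.
apply/idP/idP => h; last first.
  by have := @image_length_mono F k (n - 2); rewrite -/S; lia.
rewrite leqNgt; apply/negP => h'.
have : S (n - 2).+1 <= S k by apply: image_length_mono; lia.
by rewrite {1}/S image_lengthS -/S; case: (F _); lia.
Qed.

(** The value k = n-2 is excluded, as it gives S(k) + 3 = S(n). *)
Lemma image_length_le_a n k : 2 <= n -> F n.-1 != F n -> F k.+1 = la ->
  S k + 4 <= S n -> k + 3 <= n.
Proof.
move=> n2 nF Fk h; have kn : k + 2 <= n by rewrite -image_length_le //; lia.
rewrite addnS ltn_neqAle kn andbT; apply/eqP => E.
by move: h; rewrite -(image_length_pred n2 nF) -E addnK; lia.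
Qed.

(** The last two blocks are ab, a or a, ab, so the image ends in ba or ab. *)
Lemma image_length_ends n :
  2 <= n -> F n.-1 != F n -> F (S n).-1 != F (S n).
Proof.
case: n => [|[|n]] //= _.
have S1 := image_lengthS F n; have S2 := image_lengthS F n.+1.
rewrite -/S in S1 S2; case E1: (F n.+1) S1 => S1;
  case E2: (F n.+2) S2 => S2 // _.
  rewrite S2 addn1 (letter_image_length1 n.+1) S1 addn2.
  by rewrite letter_image_length2.
by rewrite S2 addn2 letter_image_length1 letter_image_length2.
Qed.

Lemma f_ge2 m : 2 <= f m.+1.
Proof.
by case: m => // m; rewrite fS; have := f_gt0 m; have := f_gt0 m.+1; lia.
Qed.

(** The four facts feed one joint induction: sigma carries the shift f_m to f_(m+1), and the
    differing end letters turn bounds on positions of the image into bounds on k. *)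
Lemma fibonacci_prefix m :
  [/\ S (f m) = f m.+1, S (f m.+1) = f m.+2,
      F (f m.+1).-1 != F (f m.+1) &
      forall i, 0 < i -> i + 2 <= f m.+1 -> F (i + f m) = F i].
Proof.
elim: m => [|m [S0 S1 nF per]].
  split=> [|||i]; rewrite ?image_length1 ?image_length2 //; last first.
    by move=> i0; rewrite /f /=; lia.
  by rewrite (proj1 hF) (@letter_image_length2 0 (proj1 hF)).
have f2 := f_ge2 m.
have Sadd k : k + 2 <= f m.+1 -> S (k + f m) = S k + f m.+1.
  by move=> hk; rewrite /S image_length_add -/S ?S0 // => i hi; apply: per; lia.
have per' i : 0 < i -> i + 2 <= f m.+2 -> F (i + f m.+1) = F i.
  case: (image_positionP i) => // k => [_|Fk _] h.
    have hk : k + 2 <= f m.+1 by rewrite -image_length_le // S1; lia.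
    by rewrite addSn -Sadd // !letter_image_length1.
  have hk : k + 3 <= f m.+1 by apply: image_length_le_a => //; rewrite S1; lia.
  rewrite !addSn -Sadd; last by lia.
  rewrite (letter_image_length2 Fk); apply: letter_image_length2.
  by rewrite -addSn per //; lia.
split=> //.
  (* The new period f_(m+1) is applied to the first f_m letters, which are in range because f_(m+1)
     >= 2. *)
  rewrite [f m.+2]fS addnC /S image_length_add -/S ?S0 ?S1 ?[RHS]fS 1?addnC //.
  move=> i hi; apply: per'; rewrite ?fS; lia.
by rewrite -S1; exact: image_length_ends.
Qed.

(** Passing from n to the index k or k+1 of its block turns the shift f_(m+2) into f_(m+1), where
    the induction hypothesis applies. *)
Lemma a_shift m n : f m <= n.+1 -> n + 2 <= f m.+2 ->
  a F (n + f m.+1) = (a F n).+1.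
Proof.
elim: m n => [|m IH] n h1 h2.
  have : n = 0 \/ n = 1 by move: h2; rewrite /f /=; lia.
  have a2 : a F 2 = a F 1 := a_image_length2 (proj1 hF).
  have a1 : a F 1 = (a F 0).+1 := a_image_length1 0.
  have a3 : a F 3 = (a F 1).+1 by rewrite -a_image_length1 image_length1.
  by case=> ->; rewrite /f /= ?a3 ?a2 ?a1 a0.
have [S0 S1 nF1 per1] := fibonacci_prefix m.
have [_ S2 nF2 per2] := fibonacci_prefix m.+1.
have Sadd k : k + 2 <= f m.+2 -> S (k + f m.+1) = S k + f m.+2.
  by move=> hk; rewrite /S image_length_add -/S ?S1 // => i hi;
    apply: per2; lia.
(* By contraposition: k <= f_m - 2 forces S(k) <= f_(m+1) - 3. For m = 0 the bound is trivial, as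
   f_0 = 1. *)
have lower k : f m.+1 <= S k + 2 -> f m <= k.+1.
  case: m S0 {IH h1 h2 S1 nF1 per1 S2 nF2 per2 Sadd} => // m S0 h.
  have [_ _ nF _] := fibonacci_prefix m.
  rewrite leqNgt; apply/negP => h'.
  have : S k + 3 <= S (f m.+1) by rewrite image_length_le ?f_ge2 //; lia.
  by rewrite S0; lia.
move: h1 h2; case: (image_positionP n) => [|k|k Fk] h1 h2.
- by have := f_ge2 m; lia.
- have hk : k + 2 <= f m.+2 by rewrite -image_length_le ?f_ge2 // S2; lia.
  rewrite addSn -Sadd // !a_image_length1 IH //; apply: lower; lia.
(* The sharper bound lets the period reach position k+1, so the shifted block is again ab. *)
- have hk : k + 3 <= f m.+2.
    by apply: image_length_le_a => //; rewrite ?f_ge2 // S2; lia.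
  have lk : f m <= k.+2.
    by have := @lower k.+1; rewrite /S image_lengthS Fk -/S; lia.
  rewrite !addSn -Sadd ?a_image_length2 ?(a_image_length2 Fk) //; last by lia.
    by rewrite -addSn IH //; lia.
  by rewrite -addSn per2 //; lia.
Qed.

End FibonacciWord.

(** * Vectors of values and the recurrence *)

Lemma size_avec F i j : size (avec F i j) = j.+1 - i.
Proof. by rewrite size_map size_iota. Qed.

Lemma avec_cat F i j k :
  i <= j.+1 -> j <= k -> avec F i j ++ avec F j.+1 k = avec F i k.
Proof.
move=> ij jk; rewrite /avec -map_cat /index_iota.
have -> : k.+1 - i = (j.+1 - i) + (k.+1 - j.+1) by lia.
by rewrite iotaD subnKC.
Qed.

Lemma avec_shift F i j d :
  (forall n, i <= n <= j -> a F (n + d) = (a F n).+1) ->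
  avec F (i + d) (j + d) = [seq x.+1 | x <- avec F i j].
Proof.
move=> H; rewrite /avec /index_iota -addSn subnDr addnC iotaDl -!map_comp.
by apply/eq_in_map => n; rewrite mem_iota /= => hn; rewrite addnC H //; lia.
Qed.

Lemma vadd1 u : vadd u (nseq (size u) 1) = [seq x.+1 | x <- u].
Proof. by rewrite /vadd; elim: u => //= x u ->; rewrite addn1. Qed.

Theorem theorem4p1 (F : nat -> letter) (hF : fibonacci_sequence F) :
  [/\ avec F 1 1 = [:: 1],
      avec F 2 3 = [:: 1; 2]
    & forall m : nat, 3 <= m ->
        let lhs := avec F (f m - 1) (f (m + 1) - 2) in
        let rhs := avec F (f (m - 2) - 1) (f (m - 1) - 2) ++
                   avec F (f (m - 1) - 1) (f m - 2) in
        [/\ size lhs = f (m - 1),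
            size rhs = f (m - 1)
          & lhs = vadd rhs (nseq (f (m - 1)) 1)]].
Proof.
have a1 : a F 1 = 1 by rewrite (a_image_length1 hF 0) a0.
have a2 : a F 2 = 1 by rewrite (@a_shift F hF 0 0) // a0.
have a3 : a F 3 = 2 by rewrite (@a_shift F hF 0 1) // a1.
split=> [||m]; [by rewrite /avec /= a1|by rewrite /avec /= a2 a3|].
(* From here [m] stands for m-2 of the statement. *)
case: m => [|[|m]] // _ /=; rewrite addn1.
have -> : m.+2 - 1 = m.+1 by lia.
have -> : m.+2 - 2 = m by lia.
have h0 := f_gt0 m; have h1 := f_ge2 m.
have E1 : f m <= f m.+1 by case: (m) => // k; rewrite fS leq_addr.
have E2 := fS m; have E3 := fS m.+1.
(* The two right-hand ranges are adjacent and merge into one, exactly the range of [a_shift]. *)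
have -> : f m.+1 - 1 = (f m.+1 - 2).+1 by lia.
rewrite avec_cat; [|lia|lia].
have sz : size (avec F (f m - 1) (f m.+2 - 2)) = f m.+1.
  by rewrite size_avec; lia.
have -> : avec F (f m.+2 - 1) (f m.+3 - 2) =
          [seq x.+1 | x <- avec F (f m - 1) (f m.+2 - 2)].
  rewrite -(@avec_shift _ _ _ (f m.+1)) => [|n hn].
    by congr avec; lia.
  by apply: a_shift => //; lia.
by rewrite size_map sz; split=> //; rewrite -[in RHS]sz vadd1.
Qed.
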